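(* The map $\bar{T}:\mathcal{F}^+\to\overline{M}$, $f\mapsto(\mu_f(x)f(x,y))_{(x,y)\in\mathcal{E}}$, has the following properties: (1) $\bar{T}|_{\mathcal{W}}=T$, where $T:\mathcal{W}\to M$, $w\mapsto(\mu_w(x)w(x,y))_{(x,y)\in\mathcal{E}}$, is a diffeomorphism. (2) $\bar{T}$ is a diffeomorphism; its inverse $\bar{\tau}:\overline{M}\to\mathcal{F}^+$ is given by $$\bar{\tau}(\eta):\mathcal{E}\to\mathbb{R},\qquad (x,y)\mapsto r(\eta)\frac{\eta_{xy}}{\eta^x}.$$ (3) $\bar{T}(af)=a\bar{T}(f)$ for all $f\in\mathcal{F}^+$ and $a>0$.
   Context: Let $\mathcal{X}=\{0,1,\dots,d\}$ with $d\ge 1$ and $\mathcal{E}\subset\mathcal{X}\times\mathcal{X}$. Assume $\mathcal{E}$ is strongly connected: for any $x,y\in\mathcal{X}$ there exist $N\ge 2$ and $(x_1,x_2),\dots,(x_{N-1},x_N)\in\mathcal{E}$ with $x_1=x$, $x_N=y$. Let $\mathcal{F}^+=\{f:\mathcal{E}\to\mathbb{R}\mid f(x,y)>0\ \text{for all }(x,y)\in\mathcal{E}\}$ and $\mathcal{W}=\{w\in\mathcal{F}^+\mid\sum_{y:(x,y)\in\mathcal{E}}w(x,y)=1\ \text{for all }x\in\mathcal{X}\}$. For $f\in\mathcal{F}^+$ let $A(f)=[a_{ij}(f)]_{0\le i,j\le d}$ with $a_{ij}(f)=f(i,j)$ if $(i,j)\in\mathcal{E}$ and $0$ otherwise; it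 is nonnegative and irreducible. Let $r(f)>0$ be its Perron-Frobenius root (the simple real eigenvalue with $r(f)\ge|\lambda|$ for every eigenvalue $\lambda$), and $\mu_f=(\mu_f(0),\dots,\mu_f(d))^T$ the unique left eigenvector, $\mu_f^TA(f)=r(f)\mu_f^T$, with all $\mu_f(x)>0$ and $\sum_x\mu_f(x)=1$. Let $\overline{M}=\{\eta=(\eta_{xy})_{(x,y)\in\mathcal{E}}\mid\eta_{xy}>0\}\subset\mathbb{R}^{|\mathcal{E}|}$. For $\eta\in\overline{M}$ put $r(\eta)=\sum_{(x,y)\in\mathcal{E}}\eta_{xy}$ and $\eta^x=\sum_{k:(k,x)\in\mathcal{E}}\eta_{kx}$. Let $M=\{\eta\in\overline{M}\mid\sum_{(x,y)\in\mathcal{E}}\eta_{xy}=1\ \text{and}\ \sum_{y:(x,y)\in\mathcal{E}}\eta_{xy}=\sum_{y:(y,x)\in\mathcal{E}}\eta_{yx}\ \text{for all }x\in\mathcal{X}\}$. *)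

(* Defs.v *)
From HB Require Import structures.
From mathcomp Require Import all_boot all_order all_algebra.
From mathcomp Require Import all_classical all_reals all_analysis.
From mathcomp Require Import complex.

Set Implicit Arguments.
Unset Strict Implicit.
Unset Printing Implicit Defensive.

Import Order.TTheory GRing.Theory Num.Theory.
Import numFieldNormedType.Exports.

Local Open Scope classical_set_scope.
Local Open Scope ring_scope.

(* Class C^k on an open set U: all iterated partial derivatives up to order k
   exist and are continuous on U. *)
Fixpoint Ck (R : realType) (n k : nat) (U : set 'rV[R]_n) (g : 'rV[R]_n -> R) :
    Prop :=
  (forall u, U u -> {for u, continuous g}) /\
  match k with
  | 0%N => True
  | k'.+1 => forall j : 'I_n,
      (forall u, U u -> derivable g u (delta_mx 0 j)) /\
      Ck k' U (fun u => 'D_(delta_mx 0 j) g u)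
  end.

Definition smooth_open (R : realType) (n m : nat) (U : set 'rV[R]_n)
    (F : 'rV[R]_n -> 'rV[R]_m) : Prop :=
  forall (k : nat) (j : 'I_m), Ck k U (fun u => F u 0 j).

(* Smoothness on an arbitrary subset S of R^n: near each point of S the map
   extends to a C^oo map on an open set.  For S open, or S a submanifold of
   R^n, this is the usual notion. *)
Definition smooth_map (R : realType) (n m : nat) (S : set 'rV[R]_n)
    (F : 'rV[R]_n -> 'rV[R]_m) : Prop :=
  forall u, S u -> exists (U : set 'rV[R]_n) (G : 'rV[R]_n -> 'rV[R]_m),
    [/\ open U, U u, smooth_open U G & {in U `&` S, G =1 F}].

Definition inverse_maps (X Y : Type) (A : set X) (B : set Y)
    (F : X -> Y) (G : Y -> X) : Prop :=
  [/\ set_fun A B F, set_fun B A G, {in A, cancel F G} & {in B, cancel G F}].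

Definition diffeomorphism (R : realType) (n m : nat) (A : set 'rV[R]_n)
    (B : set 'rV[R]_m) (F : 'rV[R]_n -> 'rV[R]_m) : Prop :=
  exists G : 'rV[R]_m -> 'rV[R]_n,
    [/\ inverse_maps A B F G, smooth_map A F & smooth_map B G].

Definition strongly_connected (d : nat) (E : {set 'I_d.+1 * 'I_d.+1}) : Prop :=
  forall x y : 'I_d.+1, exists p : seq 'I_d.+1,
    [/\ p != [::], path (fun u v => (u, v) \in E) x p & last x p = y].

(* Real families indexed by E are row vectors of length #|E|, the e-th
   coordinate belonging to the edge enum_val e.  [at_edge f x y] is f(x,y) if
   (x,y) is an edge and 0 otherwise; [edge_row] converts back. *)
Definition at_edge (R : realType) (d : nat) (E : {set 'I_d.+1 * 'I_d.+1})
    (f : 'rV[R]_#|E|) (x y : 'I_d.+1) : R :=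
  if [pick e : 'I_#|E| | enum_val e == (x, y)] is Some e then f 0 e else 0.

Definition edge_row (R : realType) (d : nat) (E : {set 'I_d.+1 * 'I_d.+1})
    (g : 'I_d.+1 -> 'I_d.+1 -> R) : 'rV[R]_#|E| :=
  \row_(e < #|E|) g (enum_val e).1 (enum_val e).2.

Definition Fplus (R : realType) (d : nat) (E : {set 'I_d.+1 * 'I_d.+1}) :
    set 'rV[R]_#|E| :=
  [set f | forall x y, (x, y) \in E -> 0 < at_edge f x y].
Arguments Fplus R {d} E _.

Definition Wset (R : realType) (d : nat) (E : {set 'I_d.+1 * 'I_d.+1}) :
    set 'rV[R]_#|E| :=
  [set w | Fplus R E w /\
           forall x, \sum_(y | (x, y) \in E) at_edge w x y = 1].
Arguments Wset R {d} E _.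

Definition Mbar (R : realType) (d : nat) (E : {set 'I_d.+1 * 'I_d.+1}) :
    set 'rV[R]_#|E| :=
  [set eta | forall x y, (x, y) \in E -> 0 < at_edge eta x y].
Arguments Mbar R {d} E _.

Definition total_mass (R : realType) (d : nat) (E : {set 'I_d.+1 * 'I_d.+1})
    (eta : 'rV[R]_#|E|) : R :=
  \sum_(p in E) at_edge eta p.1 p.2.

Definition in_mass (R : realType) (d : nat) (E : {set 'I_d.+1 * 'I_d.+1})
    (eta : 'rV[R]_#|E|) (x : 'I_d.+1) : R :=
  \sum_(k | (k, x) \in E) at_edge eta k x.

Definition Mset (R : realType) (d : nat) (E : {set 'I_d.+1 * 'I_d.+1}) :
    set 'rV[R]_#|E| :=
  [set eta | [/\ Mbar R E eta, total_mass eta = 1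
    & forall x, \sum_(y | (x, y) \in E) at_edge eta x y
                = \sum_(y | (y, x) \in E) at_edge eta y x]].
Arguments Mset R {d} E _.

Definition edge_matrix (R : realType) (d : nat) (E : {set 'I_d.+1 * 'I_d.+1})
    (f : 'rV[R]_#|E|) : 'M[R]_d.+1 :=
  \matrix_(i, j) (if (i, j) \in E then at_edge f i j else 0).

(* "Simple" is algebraic simplicity; the domination is over all complex
   eigenvalues. *)
Definition is_PF_root (R : realType) (n : nat) (A : 'M[R]_n) (r : R) : Prop :=
  [/\ 0 < r, eigenvalue A r, mup r (char_poly A) = 1%N
    & forall l : R[i], eigenvalue (map_mx (real_complex R) A) l ->
        `|l| <= real_complex R r].

Definition PF_root (R : realType) (n : nat) (A : 'M[R]_n) : R :=
  get [set r | is_PF_root A r].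

Definition PF_left_vector (R : realType) (n : nat) (A : 'M[R]_n) : 'rV[R]_n :=
  get [set mu : 'rV[R]_n | [/\ mu *m A = PF_root A *: mu,
         forall x, 0 < mu 0 x & \sum_x mu 0 x = 1]].

Definition mu_ (R : realType) (d : nat) (E : {set 'I_d.+1 * 'I_d.+1})
    (f : 'rV[R]_#|E|) (x : 'I_d.+1) : R :=
  PF_left_vector (edge_matrix f) 0 x.

Definition Tbar (R : realType) (d : nat) (E : {set 'I_d.+1 * 'I_d.+1})
    (f : 'rV[R]_#|E|) : 'rV[R]_#|E| :=
  edge_row E (fun x y => mu_ f x * at_edge f x y).
Arguments Tbar {R d E} _.

(* Only the values on [Wset E] matter. *)
Definition Tmap (R : realType) (d : nat) (E : {set 'I_d.+1 * 'I_d.+1})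
    (w : 'rV[R]_#|E|) : 'rV[R]_#|E| :=
  edge_row E (fun x y => mu_ w x * at_edge w x y).
Arguments Tmap {R d E} _.

Definition taubar (R : realType) (d : nat) (E : {set 'I_d.+1 * 'I_d.+1})
    (eta : 'rV[R]_#|E|) : 'rV[R]_#|E| :=
  edge_row E (fun x y => total_mass eta * (at_edge eta x y / in_mass eta x)).
Arguments taubar {R d E} _.

(* Main.v *)
(* If [mu] is the normalized left Perron vector of [A(f)] then [eta = Tbar f]
   satisfies [eta^x = r(f) mu(x)] and [r(eta) = r(f)], so [f] is recovered from
   [eta] rationally.  Conversely [eta^x / r(eta)] is a positive left eigenvector
   of [A(taubar eta)], and irreducibility makes positive eigenvectors unique.

   Smoothness of [Tbar] is smoothness of [mu].  If [nu] is the normalized right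
   Perron vector, multiplying the two eigenvector equations gives
     (r(g) - r(f)) (mu_f . nu_g) = mu_f (A(g) - A(f)) nu_g,
   whence [r] is continuous, and differentiable as soon as [nu] is continuous.
   On the other hand [A(f) - r(f) + J], where [J] is the all-ones matrix, is
   invertible and sends [mu_f] to the all-ones vector, so [mu] and [nu] are
   rational in [f] and [r].  These two facts bootstrap each other, and [r] is of
   class C^k for every [k]. *)

Require Import Defs.
From mathcomp Require Import all_boot all_order all_algebra.
From mathcomp Require Import all_classical all_reals all_analysis.
From mathcomp Require Import complex ring lra.

Set Implicit Arguments.
Unset Strict Implicit.
Unset Printing Implicit Defensive.

Import Order.TTheory GRing.Theory Num.Theory.
Import numFieldNormedType.Exports.
Local Open Scope classical_set_scope.
Local Open Scope ring_scope.

(** * Perron-Frobenius theorem *)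

Section perron_frobenius.
Context {R : realType}.

(** Strong connectivity of the graph of positive entries, put as an induction principle: a property
    that holds somewhere and propagates along arcs holds everywhere. *)
Definition irreducible_mx (n : nat) (A : 'M[R]_n) : Prop :=
  (forall i j, 0 <= A i j) /\
  (forall P : 'I_n -> Prop, (exists x, P x) ->
     (forall u v, P u -> 0 < A u v -> P v) -> forall y, P y).

(** The complement of a set closed under the arcs of [A^T] is closed under the arcs of [A]. *)
Lemma irreducible_trmx n (A : 'M[R]_n) :
  irreducible_mx A -> irreducible_mx A^T.
Proof.
move=> [A0 Airr]; split=> [i j|P [x Px] Pcl y]; first by rewrite mxE.
have [//|nPy] := pselect (P y).
have nP : forall z, ~ P z.
  apply: Airr => [|u v nPu Auv Pv]; first by exists y.
  by apply: nPu; apply: (Pcl v); rewrite ?mxE.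
by have := nP x.
Qed.

Lemma mulmx_row_ge n (A : 'M[R]_n) (v : 'rV[R]_n) (i j : 'I_n) :
  (forall i j, 0 <= A i j) -> (forall i, 0 <= v 0 i) ->
  v 0 i * A i j <= (v *m A) 0 j.
Proof.
move=> A0 v0; rewrite mxE (bigD1 i) //= lerDl sumr_ge0 // => k _.
exact: mulr_ge0.
Qed.

(** The support of [v] is closed under arcs: [v i > 0] and [A i j > 0] make [(v A) j = r v j]
    positive, so [v j] cannot vanish. *)
Lemma eigenvector_gt0 n (A : 'M[R]_n) (v : 'rV[R]_n) (r : R) :
  irreducible_mx A -> v *m A = r *: v -> (forall i, 0 <= v 0 i) ->
  (exists i, v 0 i != 0) -> forall i, 0 < v 0 i.
Proof.
move=> [A0 Airr] vA v0 [x vx]; apply: Airr => [|i j vi Aij].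
  by exists x; rewrite lt0r vx v0.
rewrite lt0r v0 andbT; apply: contraTneq (mulr_gt0 vi Aij) => vj.
by rewrite -leNgt (le_trans (mulmx_row_ge i j A0 v0)) // vA mxE vj mulr0.
Qed.

(* Subtracting from [v] the largest multiple of [mu] that keeps it nonnegative
   creates a zero entry, which irreducibility forbids in a nonzero vector. *)
Lemma eigenvector_unique n (A : 'M[R]_n) (mu v : 'rV[R]_n) (r : R) :
  irreducible_mx A -> mu *m A = r *: mu -> (forall i, 0 < mu 0 i) ->
  v *m A = r *: v -> exists c, v = c *: mu.
Proof.
case: n A mu v => [|n] A mu v Airr muA mu0 vA.
  by exists 0; apply/rowP => -[].
pose q (i : 'I_n.+1) := v 0 i / mu 0 i.
have [i0 _ qmin] := @Order.TotalTheory.arg_minP _ _ _ ord0 xpredT q isT.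
exists (q i0); apply/eqP; rewrite -subr_eq0; apply/eqP.
set w := v - _.
have w0 i : 0 <= w 0 i.
  by rewrite !mxE subr_ge0 -ler_pdivlMr // qmin.
have wA : w *m A = r *: w.
  by rewrite mulmxBl -scalemxAl vA muA scalerBr !scalerA mulrC.
have wi0 : w 0 i0 = 0 by rewrite !mxE divfK ?subrr // gt_eqF.
apply/rowP => i; rewrite [RHS]mxE; apply/eqP/negPn/negP => wi.
have := eigenvector_gt0 Airr wA w0 (ex_intro _ i wi) i0.
by rewrite wi0 ltxx.
Qed.

(** The summand [A] spreads the support along arcs, while the identity keeps every entry from
    decreasing, so the largest of the exponents found entrywise serves all entries. *)
Lemma iter_id_plus_gt0 n (A : 'M[R]_n) (v : 'rV[R]_n) :
  irreducible_mx A -> (forall i, 0 <= v 0 i) -> (exists i, v 0 i != 0) ->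
  exists k, forall i, 0 < iter k (fun w => w + w *m A) v 0 i.
Proof.
move=> [A0 Airr] v0 [x vx]; pose f (w : 'rV[R]_n) := w + w *m A.
have pos k i : 0 <= iter k f v 0 i.
  elim: k i => [//|k IH] i /=; rewrite !mxE addr_ge0 // sumr_ge0 // => j _.
  exact: mulr_ge0.
have mono k l i : (k <= l)%N -> iter k f v 0 i <= iter l f v 0 i.
  move=> /subnK <-; elim: (l - k)%N => [//|m IH] /=.
  rewrite (le_trans IH) // !mxE lerDl sumr_ge0 // => j _.
  exact: mulr_ge0.
have : forall y, exists k, 0 < iter k f v 0 y.
  apply: Airr => [|i j [k vk] Aij]; first by exists x, 0%N; rewrite lt0r vx v0.
  exists k.+1; rewrite /= mxE ltr_wpDl //.
  by rewrite (lt_le_trans _ (mulmx_row_ge i j A0 (pos k))) // mulr_gt0.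
move=> /choice[k kP]; exists (\max_i k i)%N => i.
by rewrite (lt_le_trans (kP i)) // mono // leq_bigmax.
Qed.

(** * Existence of a Perron eigenvector by maximization over the simplex *)

Definition simplex n : set 'rV[R]_n :=
  [set x | (forall i, 0 <= x 0 i) /\ \sum_i x 0 i = 1].

Lemma linear_form_continuous n (w : 'I_n -> R) :
  continuous (fun x : 'rV[R]_n => \sum_i x 0 i * w i).
Proof.
move=> x; apply: (@cvg_big R 'I_n +%R 0 xpredT _ _ (nbhs x)) => [|i _].
  exact: add_continuous.
by apply: (@cvgM _ _ (nbhs x)); [apply: coord_continuous | apply: cvg_cst].
Qed.

Lemma closed_forall_ge (T : topologicalType) n (f : 'I_n -> T -> R) :
  (forall i, continuous (f i)) -> closed [set x | forall i, 0 <= f i x].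
Proof.
move=> fc.
rewrite (_ : mkset _ = \bigcap_(i in setT) (f i @^-1` [set y | 0 <= y])).
  apply: closed_bigI => i _; move/continuous_closedP: (fc i); apply.
  exact: closed_ge.
by apply/seteqP; split=> x /= xP i *; apply: xP.
Qed.

Lemma simplex_le1 n (x : 'rV[R]_n) i : simplex x -> x 0 i <= 1.
Proof.
by move=> [x0 <-]; rewrite (bigD1 i) //= lerDl sumr_ge0.
Qed.

Lemma simplex_compact n : compact (@simplex n).
Proof.
apply: (subclosed_compact
  (B := [set x : 'rV[R]_n | forall i, `[0, 1]%classic (x ord0 i)])).
- apply: closedI.
    by apply: closed_forall_ge => i; exact: coord_continuous.
  have := @linear_form_continuous n (fun=> 1).
  move/continuous_closedP => /(_ [set 1] (@closed_eq _ 1)).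
  congr closed; apply/seteqP; split=> x /=;
  have -> : \sum_i x 0 i * 1 = \sum_i x 0 i.
  - by apply: eq_bigr => i _; rewrite mulr1.
  - by [].
  - by apply: eq_bigr => i _; rewrite mulr1.
  - by [].
- apply: (@rV_compact R n (fun=> `[0, 1]%classic)) => i.
  exact: segment_compact.
- by move=> x xS i /=; rewrite in_itv /= simplex_le1 // andbT; case: xS.
Qed.

(** The Collatz-Wielandt inequality; for irreducible [A] of size at least 2 the largest [s] it
    allows on the simplex is the Perron root. *)
Definition subinvariant n (A : 'M[R]_n) (s : R) (x : 'rV[R]_n) : Prop :=
  forall j, s * x 0 j <= (x *m A) 0 j.

(** Sum the inequalities over [j] and bound each [x i] by 1. This confines [s] to a bounded range,
    as the compactness argument requires. *)
Lemma subinvariant_le n (A : 'M[R]_n) s x : (forall i j, 0 <= A i j) ->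
  simplex x -> subinvariant A s x -> s <= \sum_j \sum_i A i j.
Proof.
move=> A0 xS sx; have [_ x1] := xS.
rewrite -[leLHS]mulr1 -x1 mulr_sumr; apply: ler_sum => j _.
rewrite (le_trans (sx j)) // mxE; apply: ler_sum => i _.
by rewrite ler_piMl // simplex_le1.
Qed.

Lemma exists_max_subinvariant n (A : 'M[R]_n) : (0 < n)%N ->
  (forall i j, 0 <= A i j) ->
  exists r x, [/\ 0 <= r, simplex x, subinvariant A r x &
    forall s y, simplex y -> subinvariant A s y -> s <= r].
Proof.
move=> n0 A0; set B := \sum_j \sum_i A i j.
pose K := (@simplex n `*` `[0, B]%classic) `&`
  [set p : 'rV[R]_n * R | forall j, 0 <= (p.1 *m A) 0 j - p.2 * p.1 0 j].
have Kcompact : compact K.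
  have SBcompact := compact_setX (@simplex_compact n) (@segment_compact R 0 B).
  apply: (subclosed_compact _ SBcompact); last by move=> ? [].
  apply: closedI.
    by apply: compact_closed SBcompact; exact: norm_hausdorff.
  apply: closed_forall_ge => j p; apply: cvgB.
    under eq_fun do rewrite mxE.
    rewrite mxE.
    have : {for p, continuous
        ((fun x : 'rV[R]_n => \sum_i x 0 i * A i j) \o (@fst 'rV[R]_n R))}.
      apply: continuous_comp; first exact: cvg_fst.
      exact: linear_form_continuous.
    exact.
  apply: cvgM; first exact: cvg_snd.
  have : {for p, continuous ((fun x : 'rV[R]_n => x 0 j) \o (@fst 'rV[R]_n R))}.
    by apply: continuous_comp; [exact: cvg_fst | exact: coord_continuous].
  exact.
have K0 : K !=set0.
  exists (delta_mx 0 (Ordinal n0), 0); split; first split => /=.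
  - split=> [i|]; first by rewrite mxE eqxx ler0n.
    rewrite (bigD1 (Ordinal n0)) //= big1 ?mxE ?eqxx ?addr0 // => i /negPf ni.
    by rewrite mxE ni andbF.
  - by rewrite in_itv /= lexx sumr_ge0 // => j _; rewrite sumr_ge0.
  - move=> j /=; rewrite mul0r subr0 mxE sumr_ge0 // => i _.
    by rewrite mulr_ge0 // mxE ler0n.
have [|[x r] /set_mem[[/= xS]]] := compact_EVT_max K0 Kcompact (f := snd).
  by apply: continuous_subspaceT => p; exact: cvg_snd.
rewrite in_itv /= => /andP[r0 _] rx rmax.
exists r, x; split=> // [j|s y yS sy]; first by rewrite -subr_ge0.
(* The set [K] only contains pairs with [s] in [[0, B]]: a negative [s] is below [r] anyway, and the
   upper bound is automatic. *)
have [s0|/ltW s0] := leP 0 s; last exact: le_trans s0 r0.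
apply: (rmax (y, s)); apply/mem_set; split; first split=> //=.
  by rewrite in_itv /= s0; exact: subinvariant_le sy.
by move=> j /=; rewrite subr_ge0.
Qed.

Lemma exists_pos_lower_bound n (w : 'I_n -> R) : (forall i, 0 < w i) ->
  exists2 e, 0 < e & forall i, e <= w i.
Proof.
case: n w => [|n] w w0; first by exists 1 => // -[].
have [i _ imin] := @Order.TotalTheory.arg_minP _ _ _ ord0 xpredT w isT.
by exists (w i) => // j; exact: imin.
Qed.

(* Collatz-Wielandt: if a subinvariant vector for the largest possible [r] were
   not an eigenvector, applying a power of [1 + A] would make every inequality
   strict and [r] could be increased. *)
Lemma max_subinvariant_eigenvector n (A : 'M[R]_n) r x :
  irreducible_mx A -> simplex x -> subinvariant A r x ->
  (forall s y, simplex y -> subinvariant A s y -> s <= r) ->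
  x *m A = r *: x.
Proof.
move=> Airr xS rx rmax; have [A0 _] := Airr.
apply/eqP; rewrite -subr_eq0; set w := _ - _; apply/negPn/negP => w_neq0.
have w0 i : 0 <= w 0 i by rewrite !mxE subr_ge0; have := rx i; rewrite mxE.
have [|k wk] := iter_id_plus_gt0 Airr w0.
  apply: contrapT => /forallNP wz; case/eqP: w_neq0; apply/rowP => i.
  by rewrite [RHS]mxE; apply/eqP/negPn/negP; exact: wz.
pose f (v : 'rV[R]_n) := v + v *m A.
(* Since [1 + A] commutes with [A - r], the defect of an iterate of [x] is the iterate of the defect
   [w]. *)
have fw m : iter m f w = iter m f x *m A - r *: iter m f x.
  elim: m => [//|m /= ->]; rewrite /f mulmxBl mulmxDl -scalemxAl scalerDr.
  by rewrite opprD addrACA.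
have xmono m i : x 0 i <= iter m f x 0 i.
  have [x0 _] := xS; elim: m i => [//|m IH] i /=.
  rewrite (le_trans (IH i)) // !mxE lerDl sumr_ge0 // => j _.
  by rewrite mulr_ge0 // (le_trans (x0 j)).
set y := iter k f x in fw; have [x0 x1] := xS.
pose S := \sum_i y 0 i.
have S0 : 0 < S.
  by rewrite (lt_le_trans ltr01) // -x1 ler_sum // => i _; exact: xmono.
have zS : simplex (S^-1 *: y).
  split=> [i|].
    by rewrite mxE mulr_ge0 ?invr_ge0 ?(ltW S0) // (le_trans (x0 i)) // xmono.
  under eq_bigr do rewrite mxE.
  by rewrite -mulr_sumr mulVf // gt_eqF.
(* The defect of the normalized [y] is at least [e] in every entry. As the entries of that vector
   are at most 1, it is still subinvariant for [r + e]. *)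
have [e e0 ew] := exists_pos_lower_bound (w := fun i => S^-1 * iter k f w 0 i)
  (fun i => mulr_gt0 (eq_ind_r (fun b => is_true b) S0 (invr_gt0 S)) (wk i)).
have := rmax (r + e) _ zS; rewrite leNgt ltrDl e0 => /(_ _)/negP; apply => // i.
rewrite -scalemxAl mxE [leRHS]mxE mulrDl -lerBrDl.
rewrite (le_trans _ (le_trans (ew i) _)) //.
  by rewrite ler_piMr ?(ltW e0) //; have := simplex_le1 i zS; rewrite mxE.
rewrite fw -/y !mxE; lra.
Qed.

Lemma exists_PF_eigenvector n (A : 'M[R]_n) : (1 < n)%N -> irreducible_mx A ->
  exists r (mu : 'rV[R]_n), [/\ 0 < r, mu *m A = r *: mu,
    forall i, 0 < mu 0 i & \sum_i mu 0 i = 1].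
Proof.
move=> n1 Airr; have [A0 Aconn] := Airr.
have [r [x [r0 xS rx rmax]]] := exists_max_subinvariant (ltnW n1) A0.
have xA := max_subinvariant_eigenvector Airr xS rx rmax.
have [x0 x1] := xS.
have x_gt0 : forall i, 0 < x 0 i.
  apply: eigenvector_gt0 xA x0 _ => //; apply: contrapT => /forallNP xz.
  have := x1; rewrite big1 => [/esym/eqP|i _]; first by rewrite oner_eq0.
  by apply/eqP/negPn/negP; exact: xz.
exists r, x; split=> //; rewrite lt0r r0 andbT; apply/negP => /eqP rz.
(* If [r = 0] then [x A = 0] with [x > 0], so there are no arcs; a singleton is then closed under
   arcs, which contradicts [1 < n]. *)
have : forall j : 'I_n, j = Ordinal (ltnW n1).
  apply: Aconn; first by exists (Ordinal (ltnW n1)).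
  move=> u v _ Auv; have := mulmx_row_ge u v A0 x0.
  by rewrite xA rz scale0r [leRHS]mxE leNgt mulr_gt0.
by move=> /(_ (Ordinal n1)) /(congr1 val).
Qed.

(** * Pairing of left and right eigenvectors; simplicity and dominance of the root *)

Definition rvdot n (x y : 'rV[R]_n) : R := \sum_i x 0 i * y 0 i.

Lemma rvdot_gt0 n (x y : 'rV[R]_n) : (0 < n)%N ->
  (forall i, 0 < x 0 i) -> (forall i, 0 < y 0 i) -> 0 < rvdot x y.
Proof.
move=> n0 x0 y0; rewrite /rvdot (bigD1 (Ordinal n0)) //=.
rewrite ltr_wpDr ?mulr_gt0 // sumr_ge0 // => i _; apply: ltW.
exact: mulr_gt0.
Qed.

Lemma rvdotZl n c (x y : 'rV[R]_n) : rvdot (c *: x) y = c * rvdot x y.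
Proof.
by rewrite /rvdot mulr_sumr; apply: eq_bigr => i _; rewrite mxE mulrA.
Qed.

Lemma rvdotC n (x y : 'rV[R]_n) : rvdot x y = rvdot y x.
Proof. by apply: eq_bigr => i _; rewrite mulrC. Qed.

Lemma rvdotZr n c (x y : 'rV[R]_n) : rvdot x (c *: y) = c * rvdot x y.
Proof. by rewrite rvdotC rvdotZl rvdotC. Qed.

Lemma rvdotBl n (x z y : 'rV[R]_n) : rvdot (x - z) y = rvdot x y - rvdot z y.
Proof.
by rewrite /rvdot -sumrB; apply: eq_bigr => i _; rewrite !mxE mulrBl.
Qed.

Lemma rvdot_trmx n (A : 'M[R]_n) (x y : 'rV[R]_n) :
  rvdot (x *m A) y = rvdot x (y *m A^T).
Proof.
rewrite /rvdot; under eq_bigr => j _ do rewrite mxE mulr_suml.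
rewrite exchange_big; apply: eq_bigr => i _.
rewrite mxE mulr_sumr; apply: eq_bigr => j _.
by rewrite mxE -mulrA [A i j * _]mulrC.
Qed.

Section PF_root_of_eigenvectors.
Context {n : nat}.
Variables (A : 'M[R]_n.+1) (r : R) (mu nu : 'rV[R]_n.+1).
Hypothesis Airr : irreducible_mx A.
Hypothesis r_gt0 : 0 < r.
Hypothesis muA : mu *m A = r *: mu.
Hypothesis mu_gt0 : forall i, 0 < mu 0 i.
Hypothesis nuA : nu *m A^T = r *: nu.
Hypothesis nu_gt0 : forall i, 0 < nu 0 i.

(** By uniqueness [v] is a multiple of [mu], and [mu . nu > 0] forces the factor to be zero. *)
Lemma left_eigenvector_rvdot_eq0 v : v *m A = r *: v -> rvdot v nu = 0 -> v = 0.
Proof.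
move=> /(eigenvector_unique Airr muA mu_gt0)[c ->].
rewrite rvdotZl => /eqP; rewrite mulf_eq0 (gt_eqF (rvdot_gt0 _ _ _)) // orbF.
by move=> /eqP ->; rewrite scale0r.
Qed.

(** Right multiplication by [replace_col0 1%:M] is the column operation that puts the product of a
    matrix with [nu] in its first column. *)
Definition replace_col0 (M : 'M[R]_n.+1) : 'M[R]_n.+1 :=
  \matrix_(i, j) if j == 0 then nu 0 i else M i j.

Lemma mulmx_replace_col0 (v : 'rV[R]_n.+1) M : v *m replace_col0 M = 0 ->
  rvdot v nu = 0 /\ forall j, j != 0 -> (v *m M) 0 j = 0.
Proof.
move=> /rowP v0; split=> [|j j0].
  have := v0 0; rewrite mxE [RHS]mxE => v00; rewrite -[RHS]v00.
  by apply: eq_bigr => i _; rewrite mxE eqxx.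
have := v0 j; rewrite mxE [RHS]mxE => v0j; rewrite mxE -[RHS]v0j.
by apply: eq_bigr => i _; rewrite [in RHS]mxE (negPf j0).
Qed.

(** A row vector in the kernel vanishes off index 0 and is orthogonal to [nu]; as [nu 0 0 > 0], its
    last entry vanishes too. *)
Lemma det_replace_col0_1 : \det (replace_col0 1%:M) != 0.
Proof.
apply/negP => /det0P[v v_neq0 /mulmx_replace_col0[vnu]].
rewrite mulmx1 => v0; case/eqP: v_neq0; apply/rowP => i; rewrite [RHS]mxE.
have [->|/v0//] := eqVneq i 0.
move: vnu; rewrite /rvdot (bigD1 0) //= big1 => [/eqP|j /v0 ->]; last first.
  by rewrite mul0r.
by rewrite addr0 mulf_eq0 (gt_eqF (nu_gt0 0)) orbF => /eqP.
Qed.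

(** For [v] in the kernel, [w = v (r - A)] vanishes off index 0. It is also orthogonal to the right
    eigenvector [nu], hence zero, so [v] is a left eigenvector orthogonal to [nu]. *)
Lemma det_replace_col0_char : \det (replace_col0 (r%:M - A)) != 0.
Proof.
apply/negP => /det0P[v v_neq0 /mulmx_replace_col0[vnu w0]].
set w := v *m _ in w0.
have wnu : rvdot w nu = 0.
  rewrite /w mulmxBr mul_mx_scalar rvdotBl rvdotZl vnu rvdot_trmx nuA.
  by rewrite rvdotZr vnu mulr0 subrr.
have w00 : w = 0.
  apply/rowP => i; rewrite [RHS]mxE; have [->|/w0//] := eqVneq i 0.
  move: wnu; rewrite /rvdot (bigD1 0) //= big1 => [/eqP|j /w0 ->]; last first.
    by rewrite mul0r.
  by rewrite addr0 mulf_eq0 (gt_eqF (nu_gt0 0)) orbF => /eqP.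
case/eqP: v_neq0; apply: left_eigenvector_rvdot_eq0 => //.
by move/eqP: w00; rewrite /w mulmxBr mul_mx_scalar subr_eq0 => /eqP.
Qed.

(* Replacing the first column of ['X - A] by [('X - A) nu = ('X - r) nu]
   extracts the factor ['X - r] from the characteristic polynomial. *)
Lemma char_poly_simple_root : mup r (char_poly A) = 1%N.
Proof.
pose Q : 'M[{poly R}]_n.+1 :=
  \matrix_(i, j) if j == 0 then (nu 0 i)%:P else char_poly_mx A i j.
pose D : 'rV[{poly R}]_n.+1 := \row_j if j == 0 then 'X - r%:P else 1.
have QD : char_poly_mx A *m map_mx polyC (replace_col0 1%:M) = Q *m diag_mx D.
  rewrite mul_mx_diag; apply/matrixP => i j; rewrite !mxE.
  have [->|j0] := eqVneq j 0.
    transitivity ('X * (nu 0 i)%:P - ((nu *m A^T) 0 i)%:P).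
      rewrite mxE rmorph_sum /=.
      under eq_bigr => k _ do rewrite !mxE eqxx mulrBl -polyCM mulrC.
      rewrite sumrB; congr (_ - _).
        rewrite (bigD1 i) //= eqxx big1 => [|k /negPf ki]; last first.
          by rewrite eq_sym ki mulr0n mulr0.
        by rewrite mulr1n addr0 mulrC.
      by apply: eq_bigr => k _; rewrite !mxE mulrC.
    by rewrite nuA mxE polyCM mulrBr mulrC [X in _ - X]mulrC.
  rewrite mulr1 (bigD1 j) //= big1 => [|k /negPf kj]; last first.
    by rewrite !mxE (negPf j0) kj mulr0n mulr0.
  by rewrite !mxE (negPf j0) eqxx mulr1 addr0.
have := congr1 determinant QD; rewrite !det_mulmx det_map_mx /= det_diag.
rewrite (bigD1 0) //= big1 => [|j /negPf j0]; last by rewrite mxE j0.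
rewrite mulr1 mxE eqxx => /(congr1 (mup r)).
(* The constant on the left has no root, and [Q] evaluated at [r] is [replace_col0 (r%:M - A)],
   which is nonsingular: only the factor ['X - r] counts. *)
rewrite mupMl; last by rewrite rootC det_replace_col0_1.
rewrite mupMr => [->|]; first by rewrite -['X - _]expr1 mup_XsubCX eqxx.
rewrite /root -horner_evalE -det_map_mx.
rewrite (_ : map_mx _ _ = replace_col0 (r%:M - A)) ?det_replace_col0_char //.
apply/matrixP => i j; rewrite !mxE; case: ifP => _ /=.
  by rewrite horner_evalE hornerC.
by rewrite horner_evalE hornerD hornerN hornerMn hornerX hornerC.
Qed.

(** Take moduli in [v A = l v] and pair with [nu]: [|l| (|v| . nu) <= |v| A . nu = r (|v| . nu)],
    and [|v| . nu > 0]. *)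
Lemma complex_eigenvalue_le (l : R[i]) :
  eigenvalue (map_mx (real_complex R) A) l -> `|l| <= real_complex R r.
Proof.
move=> /eigenvalueP[v vA v_neq0]; have [A0 _] := Airr.
pose C : {rmorphism R -> R[i]} := real_complex R.
have C0 x : 0 <= x -> 0 <= C x by move=> x0; rewrite ler0c.
pose N := \sum_i `|v 0 i| * C (nu 0 i).
have N0 : 0 < N.
  have [i vi] : exists i, v 0 i != 0.
    apply: contrapT => /forallNP vz; case/eqP: v_neq0; apply/rowP => i.
    by rewrite [RHS]mxE; apply/eqP/negPn/negP; exact: vz.
  rewrite /N (bigD1 i) //= ltr_wpDr //.
    by rewrite sumr_ge0 // => j _; rewrite mulr_ge0 // C0 // ltW.
  by rewrite mulr_gt0 ?normr_gt0 // ltcR.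
rewrite -(ler_pM2r N0) /N mulr_sumr.
have -> : C r * (\sum_i `|v 0 i| * C (nu 0 i)) =
          \sum_j \sum_i `|v 0 i| * C (A i j) * C (nu 0 j).
  rewrite exchange_big mulr_sumr; apply: eq_bigr => i _.
  transitivity (`|v 0 i| * C ((nu *m A^T) 0 i)).
    by rewrite nuA mxE rmorphM mulrCA.
  rewrite mxE rmorph_sum mulr_sumr; apply: eq_bigr => j _.
  by rewrite mxE rmorphM /= -mulrA [C _ * C _]mulrC.
apply: ler_sum => j _; rewrite mulrA -normrM -mulr_suml.
rewrite ler_wpM2r ?C0 ?(ltW (nu_gt0 j)) //.
have -> : l * v 0 j = (v *m map_mx C A) 0 j by rewrite vA mxE.
rewrite mxE (le_trans (ler_norm_sum _ _ _)) //; apply: ler_sum => i _.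
by rewrite normrM mxE (ger0_norm (C0 _ (A0 i j))).
Qed.

Lemma is_PF_root_eigenvectors : is_PF_root A r.
Proof.
split=> //; [|exact: char_poly_simple_root|exact: complex_eigenvalue_le].
apply/eigenvalueP; exists mu => //; apply/negP => /eqP mu0.
by have := mu_gt0 0; rewrite mu0 mxE ltxx.
Qed.

End PF_root_of_eigenvectors.

(** Each root dominates the other as a complex eigenvalue, so the choice made by [get] in [PF_root]
    is forced. *)
Lemma is_PF_root_le n (A : 'M[R]_n) r s :
  is_PF_root A r -> is_PF_root A s -> s <= r.
Proof.
move=> [_ _ _ rmax] [s0 es _ _].
have := rmax (real_complex R s); rewrite eigenvalue_map => /(_ es).
by rewrite ger0_norm ?ler0c ?(ltW s0) // lecR.
Qed.

Lemma PF_rootE n (A : 'M[R]_n) r : is_PF_root A r -> PF_root A = r.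
Proof.
move=> rA; apply: get_unique => // s sA.
by apply/le_anti; rewrite (is_PF_root_le rA sA) (is_PF_root_le sA rA).
Qed.

End perron_frobenius.

(** * Functions of class C^k *)

Lemma is_derive_cvg (R : realType) (V : normedModType R) (f : V -> R) (u v : V)
    (l : R) :
  h^-1 *: (f (h *: v + u) - f u) @[h --> 0^'] --> l -> is_derive u v f l.
Proof. by move=> fl; split; [exact: cvgP fl | exact: cvg_lim fl]. Qed.

Section Ck_closure.
Context {R : realType} {n : nat}.
Variable U : set 'rV[R]_n.
Hypothesis openU : open U.
Implicit Types f g : 'rV[R]_n -> R.

Lemma near_eq_on_open f g : (forall u, U u -> f u = g u) ->
  forall u, U u -> \forall v \near u, f v = g v.
Proof.
move=> fg u Uu; apply: filterS (open_nbhs_nbhs (conj openU Uu)) => v.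
exact: fg.
Qed.

(** On an open set, agreement on [U] is agreement near each point, so derivatives agree as well.
    This allows a derivative to be replaced by its formula below. *)
Lemma Ck_ext k f g : (forall u, U u -> f u = g u) -> Ck k U f -> Ck k U g.
Proof.
elim: k f g => [|k IH] f g fg [fc fd]; have e := near_eq_on_open fg;
  (split; first by move=> u Uu; rewrite /prop_for /continuous_at -(fg u Uu);
    apply: cvg_trans (fc u Uu);
    exact: (@near_eq_cvg _ _ (nbhs u) _ _ _ (e u Uu))) => // j.
have [fj fjk] := fd j; split=> [u Uu|].
  by apply: (near_eq_derivable (e u Uu)); exact: fj.
by apply: IH fjk => u Uu; apply: near_eq_derive; exact: e.
Qed.

Lemma Ck_le k f : Ck k.+1 U f -> Ck k U f.
Proof.
elim: k f => [|k IH] f; first by move=> [].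
move=> [fc fd]; split=> // j; have [? ?] := fd j; split=> //.
exact: IH.
Qed.

Lemma Ck_cst k (c : R) : Ck k U (fun=> c).
Proof.
elim: k c => [|k IH] c;
  (split; first by move=> u _; exact: cst_continuous) => // j.
split=> [u _|]; first exact: derivable_cst.
by apply: Ck_ext (IH 0) => u _; rewrite derive_cst.
Qed.

Lemma Ck_coord k (i : 'I_n) : Ck k U (fun u => u 0 i).
Proof.
elim: k => [|k IH];
  (split; first by move=> u _; exact: coord_continuous) => // j.
have D u : is_derive u (delta_mx 0 j : 'rV[R]_n) (fun u => u 0 i) ((i == j)%:R).
  have c : ((i == j)%:R : R) @[_ --> (0 : R)^'] --> ((i == j)%:R : R).
    exact: cvg_cst.
  apply: is_derive_cvg; apply: cvg_trans c.
  apply: (@near_eq_cvg _ _ (0^')).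
  apply: filterS (nbhs_dnbhs_neq (0 : R)) => h h0.
  rewrite /= !mxE eqxx addrK eq_sym -[_ *: _]/(h^-1 * _) mulrA mulVf ?mul1r //.
split=> [u _|]; first exact: ex_derive.
by apply: Ck_ext (Ck_cst k (i == j)%:R) => u _; rewrite derive_val.
Qed.

Lemma CkD k f g : Ck k U f -> Ck k U g -> Ck k U (fun u => f u + g u).
Proof.
elim: k f g => [|k IH] f g [fc fd] [gc gd];
  (split; first by move=> u Uu; apply: (@cvgD _ _ _ (nbhs u));
    [exact: fc | exact: gc]) => // j.
have [fj fjk] := fd j; have [gj gjk] := gd j; split=> [u Uu|].
  by apply: derivableD; [exact: fj | exact: gj].
apply: Ck_ext (IH _ _ fjk gjk) => u Uu.
by rewrite deriveD //; [exact: fj | exact: gj].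
Qed.

Lemma CkM k f g : Ck k U f -> Ck k U g -> Ck k U (fun u => f u * g u).
Proof.
elim: k f g => [|k IH] f g Cf Cg; have [fc fd] := Cf; have [gc gd] := Cg;
  (split; first by move=> u Uu; apply: (@cvgM _ _ (nbhs u));
    [exact: fc | exact: gc]) => // j.
have [fj fjk] := fd j; have [gj gjk] := gd j; split=> [u Uu|].
  by apply: derivableM; [exact: fj | exact: gj].
apply: Ck_ext (CkD (IH _ _ (Ck_le Cf) gjk) (IH _ _ (Ck_le Cg) fjk)) => u Uu.
by rewrite deriveM //; [exact: fj | exact: gj].
Qed.

Lemma CkN k f : Ck k U f -> Ck k U (fun u => - f u).
Proof.
by move=> Cf; apply: Ck_ext (CkM (Ck_cst k (-1)) Cf) => u _; rewrite mulN1r.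
Qed.

Lemma CkB k f g : Ck k U f -> Ck k U g -> Ck k U (fun u => f u - g u).
Proof. by move=> Cf Cg; apply: CkD => //; exact: CkN. Qed.

Lemma CkV k f : (forall u, U u -> f u != 0) -> Ck k U f ->
  Ck k U (fun u => (f u)^-1).
Proof.
elim: k f => [|k IH] f f0 Cf; have [fc fd] := Cf;
  (split; first by move=> u Uu; apply: (@cvgV _ _ (nbhs u));
    [exact: f0 | exact: fc]) => // j.
have [fj fjk] := fd j; split=> [u Uu|].
  by apply: derivableV; [exact: f0 | exact: fj].
have CV := IH _ f0 (Ck_le Cf).
apply: Ck_ext (CkN (CkM (CkM CV CV) fjk)) => u Uu.
by rewrite deriveV //; [rewrite -mulNr expr2 invfM | exact: f0 | exact: fj].
Qed.

Lemma Ck_sum k (I : Type) (r : seq I) (P : pred I) (F : I -> 'rV[R]_n -> R) :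
  (forall i, P i -> Ck k U (F i)) ->
  Ck k U (fun u => \sum_(i <- r | P i) F i u).
Proof.
move=> CF; elim: r => [|i r IH].
  by apply: Ck_ext (Ck_cst k 0) => u _; rewrite big_nil.
case: (boolP (P i)) => Pi.
  by apply: Ck_ext (CkD (CF i Pi) IH) => u _; rewrite big_cons Pi.
by apply: Ck_ext IH => u _; rewrite big_cons (negPf Pi).
Qed.

Lemma Ck_prod k (I : Type) (r : seq I) (P : pred I) (F : I -> 'rV[R]_n -> R) :
  (forall i, P i -> Ck k U (F i)) ->
  Ck k U (fun u => \prod_(i <- r | P i) F i u).
Proof.
move=> CF; elim: r => [|i r IH].
  by apply: Ck_ext (Ck_cst k 1) => u _; rewrite big_nil.
case: (boolP (P i)) => Pi.
  by apply: Ck_ext (CkM (CF i Pi) IH) => u _; rewrite big_cons Pi.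
by apply: Ck_ext IH => u _; rewrite big_cons (negPf Pi).
Qed.

Lemma Ck_det k m (B : 'rV[R]_n -> 'M[R]_m) :
  (forall i j, Ck k U (fun u => B u i j)) -> Ck k U (fun u => \det (B u)).
Proof.
move=> CB; apply: Ck_sum => s _; apply: CkM; first exact: Ck_cst.
by apply: Ck_prod => i _; exact: CB.
Qed.

(** Cramer's rule: the entries of the inverse are cofactors divided by the determinant. *)
Lemma Ck_invmx k m (B : 'rV[R]_n -> 'M[R]_m) :
  (forall u, U u -> B u \in unitmx) ->
  (forall i j, Ck k U (fun u => B u i j)) ->
  forall i j, Ck k U (fun u => invmx (B u) i j).
Proof.
move=> uB CB i j.
have CV : Ck k U (fun u => (\det (B u))^-1).
  apply: CkV (Ck_det CB) => u Uu.
  by have := uB u Uu; rewrite unitmxE unitfE.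
have Cadj : Ck k U (fun u => (-1) ^+ (j + i) * \det (row' j (col' i (B u)))).
  apply: CkM (Ck_cst k _) (Ck_det _) => a b.
  by apply: Ck_ext (CB (lift j a) (lift i b)) => u _; rewrite !mxE.
by apply: Ck_ext (CkM CV Cadj) => u Uu; rewrite /invmx uB // !mxE.
Qed.

End Ck_closure.

Lemma smooth_map_sub (R : realType) (n m : nat) (S U : set 'rV[R]_n)
    (F : 'rV[R]_n -> 'rV[R]_m) :
  open U -> S `<=` U -> smooth_open U F -> smooth_map S F.
Proof. by move=> oU SU CF u Su; exists U, F; split=> //; exact: SU. Qed.

(** * Smooth dependence of the Perron vector *)

Section eigenvector_perturbation.
Context {R : realType} {n : nat}.
Implicit Types A B : 'M[R]_n.+1.

Lemma mulmx_const1 (v : 'rV[R]_n.+1) :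
  v *m (const_mx 1 : 'M[R]_n.+1) = const_mx (\sum_i v 0 i).
Proof.
by apply/rowP => j; rewrite !mxE; apply: eq_bigr => i _; rewrite mxE mulr1.
Qed.

Lemma rvdot_const (c : R) (v : 'rV[R]_n.+1) :
  rvdot (const_mx c) v = c * \sum_i v 0 i.
Proof.
by rewrite /rvdot mulr_sumr; apply: eq_bigr => i _; rewrite mxE.
Qed.

Lemma rvdot_mul (x y : 'rV[R]_n.+1) B :
  rvdot (x *m B) y = \sum_j \sum_i x 0 i * B i j * y 0 j.
Proof. by apply: eq_bigr => j _; rewrite mxE mulr_suml. Qed.

(** Pairing a left vector of [A] with a right vector of [B] makes the identity exact, with no
    remainder, so it serves for continuity and for the derivative alike. *)
Lemma eigenvalue_sub A B (r s : R) (mu nu : 'rV[R]_n.+1) :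
  mu *m A = r *: mu -> nu *m B^T = s *: nu ->
  (s - r) * rvdot mu nu = rvdot (mu *m (B - A)) nu.
Proof.
move=> muA nuB; rewrite mulmxBr rvdotBl muA rvdot_trmx nuB.
by rewrite rvdotZl rvdotZr mulrBl.
Qed.

(** On the simplex [mu . nu >= c] whatever [nu] is, so the constant depends on [A] alone. *)
Lemma eigenvalue_sub_le A B (r s c : R) (mu nu : 'rV[R]_n.+1) :
  mu *m A = r *: mu -> simplex mu -> nu *m B^T = s *: nu -> simplex nu ->
  0 < c -> (forall i, c <= mu 0 i) ->
  `|s - r| <= c^-1 * \sum_j \sum_i `|B i j - A i j|.
Proof.
move=> muA muS nuB nuS c0 cmu; have [mu0 mu1] := muS; have [nu0 nu1] := nuS.
rewrite ler_pdivlMl //.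
apply: (@le_trans _ _ (`|s - r| * rvdot mu nu)).
  rewrite mulrC ler_wpM2l // -[c]mulr1 -nu1 mulr_sumr; apply: ler_sum => i _.
  exact: ler_wpM2r.
rewrite -[X in _ * X]ger0_norm; last first.
  by rewrite sumr_ge0 // => i _; exact: mulr_ge0.
rewrite -normrM (eigenvalue_sub muA nuB) rvdot_mul.
rewrite (le_trans (ler_norm_sum _ _ _)) //; apply: ler_sum => j _.
rewrite (le_trans (ler_norm_sum _ _ _)) //; apply: ler_sum => i _.
rewrite !normrM !mxE (ger0_norm (mu0 i)) (ger0_norm (nu0 j)).
by rewrite mulrAC ler_piMl // mulr_ile1 // simplex_le1.
Qed.

(** For [v] in the kernel, [v (A - r)] is constant; pairing with [nu] shows that the entries of [v]
    sum to 0. Then [v] is a left eigenvector, a multiple of [mu] with sum 0, hence zero. *)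
Lemma bordered_unit A (r : R) (mu nu : 'rV[R]_n.+1) : irreducible_mx A ->
  mu *m A = r *: mu -> (forall i, 0 < mu 0 i) -> \sum_i mu 0 i = 1 ->
  nu *m A^T = r *: nu -> \sum_i nu 0 i = 1 ->
  A - r%:M + const_mx 1 \in unitmx.
Proof.
move=> Airr muA mu0 mu1 nuA nu1.
rewrite unitmxE unitfE; apply/negP => /det0P[v v_neq0].
rewrite mulmxDr mulmxBr mul_mx_scalar mulmx_const1 => vB.
have v1 : \sum_i v 0 i = 0.
  have d0 : rvdot (v *m A - r *: v) nu = 0.
    by rewrite rvdotBl rvdotZl rvdot_trmx nuA rvdotZr subrr.
  have : rvdot (const_mx (- \sum_i v 0 i)) nu = 0.
    rewrite -[RHS]d0; move/eqP: vB; rewrite addr_eq0 => /eqP ->.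
    by congr rvdot; apply/rowP => i; rewrite mxE [RHS]mxE mxE.
  by rewrite rvdot_const nu1 mulr1 => /eqP; rewrite oppr_eq0 => /eqP.
move: vB; rewrite v1 -[const_mx 0]/(0 : 'rV[R]_n.+1) addr0 => /eqP.
rewrite subr_eq0 => /eqP /(eigenvector_unique Airr muA mu0)[c vc].
move: v1; rewrite vc; under eq_bigr do rewrite mxE.
rewrite -mulr_sumr mu1 mulr1 => c0.
by case/eqP: v_neq0; rewrite vc c0 scale0r.
Qed.

Lemma eigenvector_bordered A (r : R) (mu : 'rV[R]_n.+1) :
  mu *m A = r *: mu -> \sum_i mu 0 i = 1 ->
  A - r%:M + const_mx 1 \in unitmx ->
  mu = const_mx 1 *m invmx (A - r%:M + const_mx 1).
Proof.
move=> muA mu1 uA.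
rewrite -(_ : mu *m (A - r%:M + const_mx 1) = const_mx 1) ?mulmxK //.
by rewrite mulmxDr mulmxBr muA mul_mx_scalar subrr add0r mulmx_const1 mu1.
Qed.

End eigenvector_perturbation.

(** * Bootstrapping the regularity of the eigenvalue and its eigenvectors *)

Section eigen_smooth.
Context {R : realType} {p n : nat}.
Variable U : set 'rV[R]_p.
Hypothesis openU : open U.
Variable M : 'rV[R]_p -> 'M[R]_n.+1.
Variable rho : 'rV[R]_p -> R.
Variables mu nu : 'rV[R]_p -> 'rV[R]_n.+1.
Hypothesis CM : forall k i j, Ck k U (fun u => M u i j).
Hypothesis Mirr : forall u, U u -> irreducible_mx (M u).
Hypothesis muM : forall u, U u -> mu u *m M u = rho u *: mu u.
Hypothesis mu_gt0 : forall u i, U u -> 0 < mu u 0 i.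
Hypothesis mu_sum : forall u, U u -> \sum_i mu u 0 i = 1.
Hypothesis nuM : forall u, U u -> nu u *m (M u)^T = rho u *: nu u.
Hypothesis nu_gt0 : forall u i, U u -> 0 < nu u 0 i.
Hypothesis nu_sum : forall u, U u -> \sum_i nu u 0 i = 1.

Let mu_simplex u : U u -> simplex (mu u).
Proof. by move=> Uu; split=> [i|]; [exact/ltW/mu_gt0 | exact: mu_sum]. Qed.

Let nu_simplex u : U u -> simplex (nu u).
Proof. by move=> Uu; split=> [i|]; [exact/ltW/nu_gt0 | exact: nu_sum]. Qed.

(** Stated for a general family [N] so as to apply to [M] and to its transpose. *)
Lemma Ck_bordered_solution k (N : 'rV[R]_p -> 'M[R]_n.+1)
    (v : 'rV[R]_p -> 'rV[R]_n.+1) :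
  (forall i j, Ck k U (fun u => N u i j)) -> Ck k U rho ->
  (forall u, U u -> N u - (rho u)%:M + const_mx 1 \in unitmx) ->
  (forall u, U u ->
    v u = const_mx 1 *m invmx (N u - (rho u)%:M + const_mx 1)) ->
  forall i, Ck k U (fun u => v u 0 i).
Proof.
move=> CN Cr uN vE i; pose B u := N u - (rho u)%:M + const_mx 1.
apply: (Ck_ext openU (f := fun u => \sum_l invmx (B u) l i)).
  by move=> u /vE ->; rewrite mxE; apply: eq_bigr => l _; rewrite mxE mul1r.
apply: Ck_sum => // l _; apply: Ck_invmx => // a b.
apply: (Ck_ext openU (f := fun u => N u a b - rho u * (a == b)%:R + 1)).
  by move=> u _; rewrite !mxE mulr_natr.
apply: CkD => //; last exact: Ck_cst.
by apply: CkB => //; apply: CkM => //; exact: Ck_cst.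
Qed.

Lemma Ck_left_eigenvector k i : Ck k U rho -> Ck k U (fun u => mu u 0 i).
Proof.
have uM u : U u -> M u - (rho u)%:M + const_mx 1 \in unitmx.
  move=> Uu; apply: (bordered_unit (Mirr Uu) (muM Uu) _ (mu_sum Uu) (nuM Uu)).
    by move=> j; exact: mu_gt0.
  exact: nu_sum.
move=> Cr; apply: (Ck_bordered_solution (CM k) Cr uM) => u Uu.
exact: eigenvector_bordered (muM Uu) (mu_sum Uu) (uM u Uu).
Qed.

Lemma Ck_right_eigenvector k i : Ck k U rho -> Ck k U (fun u => nu u 0 i).
Proof.
have uM u : U u -> (M u)^T - (rho u)%:M + const_mx 1 \in unitmx.
  move=> Uu; apply: (@bordered_unit _ _ _ _ (nu u) (mu u)).
  - exact/irreducible_trmx/Mirr.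
  - exact: nuM.
  - by move=> j; exact: nu_gt0.
  - exact: nu_sum.
  - by rewrite trmxK muM.
  - exact: mu_sum.
move=> Cr; apply: (Ck_bordered_solution _ Cr uM) => [a b|u Uu].
  by apply: (Ck_ext openU) (CM k b a) => u _; rewrite mxE.
exact: eigenvector_bordered (nuM Uu) (nu_sum Uu) (uM u Uu).
Qed.

(** The bound uses a lower bound for [mu] at the fixed point [u] only, so no continuity of [mu] or
    [nu] is presupposed. *)
Lemma eigenvalue_continuous u : U u -> {for u, continuous rho}.
Proof.
move=> Uu; have [c c0 cmu] := exists_pos_lower_bound (fun i => mu_gt0 i Uu).
pose b v := c^-1 * \sum_j \sum_i `|M v i j - M u i j|.
have b0 : b v @[v --> u] --> (0 : R).
  have -> : (0 : R) = c^-1 * \sum_(j < n.+1) \sum_(i < n.+1) (0 : R).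
    by rewrite big1 ?mulr0 // => j _; rewrite big1.
  apply: (@cvgM _ _ (nbhs u)); first exact: cvg_cst.
  apply: (@cvg_big R _ +%R 0 xpredT _ _ (nbhs u)) => [|j _].
    exact: add_continuous.
  apply: (@cvg_big R _ +%R 0 xpredT _ _ (nbhs u)) => [|i _].
    exact: add_continuous.
  have Mij : M v i j - M u i j @[v --> u] --> M u i j - M u i j.
    apply: (@cvgB _ _ _ (nbhs u)); last exact: cvg_cst.
    by have [Mc _] := CM 0 i j; exact: Mc.
  have := @cvg_norm _ _ _ (nbhs u) _ _ _ Mij; rewrite subrr normr0; exact.
apply: (@squeeze_cvgr _ (nbhs u) _ _ (fun v => rho u - b v)
  (fun v => rho u + b v)).
- apply: filterS (open_nbhs_nbhs (conj openU Uu)) => v Uv.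
  rewrite -ler_distl.
  exact: (eigenvalue_sub_le (muM Uu) (mu_simplex Uu) (nuM Uv) (nu_simplex Uv)).
- rewrite -[X in _ --> X]subr0; apply: (@cvgB _ _ _ (nbhs u)) => //.
  exact: cvg_cst.
- rewrite -[X in _ --> X]addr0; apply: (@cvgD _ _ _ (nbhs u)) => //.
  exact: cvg_cst.
Qed.

(** The first-order perturbation (Hellmann-Feynman) formula. *)
Definition eigenvalue_derive (v u : 'rV[R]_p) : R :=
  (\sum_j \sum_i mu u 0 i * 'D_v (fun u => M u i j) u * nu u 0 j)
  / \sum_i mu u 0 i * nu u 0 i.

Lemma eigenvalue_is_derive (u : 'rV[R]_p) (a : 'I_p) : U u ->
  is_derive u (delta_mx 0 a : 'rV[R]_p) rho
    (eigenvalue_derive (delta_mx 0 a) u).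
Proof.
move=> Uu; set v : 'rV[R]_p := delta_mx 0 a; apply: is_derive_cvg.
have d0 w : U w -> 0 < rvdot (mu u) (nu w).
  by move=> Uw; apply: rvdot_gt0 => // i; [exact: mu_gt0 | exact: nu_gt0].
have cs : h *: v + u @[h --> (0 : R)^'] --> u.
  have : {for (0 : R), continuous (fun h : R => h *: v + u)}.
    apply: (@cvgD _ _ _ (nbhs (0 : R))); last exact: cvg_cst.
    apply: (@cvgZl _ _ _ (nbhs (0 : R))); exact: cvg_id.
  rewrite /prop_for /continuous_at scale0r add0r.
  exact: cvg_within_filter.
have cnu j : nu (h *: v + u) 0 j @[h --> (0 : R)^'] --> nu u 0 j.
  have [|nuc _] := @Ck_right_eigenvector 0 j.
    by split=> // w Uw; exact: eigenvalue_continuous.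
  exact: (cvg_comp _ _ cs (nuc u Uu)).
(* By [eigenvalue_sub] this is exactly the difference quotient of [rho] as long as the moved point
   lies in [U]. Here [mu] stays at [u] and only [nu] moves, so continuity of [nu] suffices for the
   limit. *)
pose q h := (\sum_j \sum_i mu u 0 i *
     (h^-1 *: (M (h *: v + u) i j - M u i j)) * nu (h *: v + u) 0 j)
  / \sum_i mu u 0 i * nu (h *: v + u) 0 i.
have cq : q h @[h --> (0 : R)^'] --> eigenvalue_derive v u.
  apply: (@cvgM _ _ ((0 : R)^')).
    apply: (@cvg_big R _ +%R 0 xpredT _ _ ((0 : R)^')) => [|j _].
      exact: add_continuous.
    apply: (@cvg_big R _ +%R 0 xpredT _ _ ((0 : R)^')) => [|i _].
      exact: add_continuous.
    apply: (@cvgM _ _ ((0 : R)^')); last exact: cnu.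
    apply: (@cvgM _ _ ((0 : R)^')); first exact: cvg_cst.
    have [_ /(_ a)[Md _]] := CM 1 i j.
    exact: Md.
  apply: (@cvgV _ _ ((0 : R)^')).
    exact: lt0r_neq0 (d0 u Uu).
  apply: (@cvg_big R _ +%R 0 xpredT _ _ ((0 : R)^')) => [|i _].
    exact: add_continuous.
  by apply: (@cvgM _ _ ((0 : R)^')); [exact: cvg_cst | exact: cnu].
apply: cvg_trans cq; apply: (@near_eq_cvg _ _ ((0 : R)^')).
have := cs _ (open_nbhs_nbhs (conj openU Uu)).
apply: (@filterS _ (0 : R)^' _) => h Uh.
have dh0 := lt0r_neq0 (d0 _ Uh).
apply: esym; apply: (mulIf dh0).
rewrite -[h^-1 *: _]/(h^-1 * _) -mulrA (eigenvalue_sub (muM Uu) (nuM Uh)).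
rewrite /q divfK // rvdot_mul mulr_sumr; apply: eq_bigr => j _.
rewrite mulr_sumr; apply: eq_bigr => i _.
by rewrite !mxE -[h^-1 *: _]/(h^-1 * _) -!mulrA mulrCA.
Qed.

(** If [rho] is of class C^k, so are [mu] and [nu], hence also the formula for the derivative of
    [rho]. *)
Lemma Ck_eigenvalue k : Ck k U rho.
Proof.
elim: k => [|k IH];
  (split; first by move=> u Uu; exact: eigenvalue_continuous) => // a.
split=> [u Uu|]; first by case: (eigenvalue_is_derive a Uu).
have Cmu i : Ck k U (fun u => mu u 0 i) by exact: Ck_left_eigenvector.
have Cnu i : Ck k U (fun u => nu u 0 i) by exact: Ck_right_eigenvector.
apply: (Ck_ext openU (f := eigenvalue_derive (delta_mx 0 a))).
  by move=> u Uu; case: (eigenvalue_is_derive a Uu).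
apply: CkM => //.
  apply: Ck_sum => // j _; apply: Ck_sum => // i _.
  apply: CkM => //; apply: CkM => //.
  by have [_ /(_ a)[_ Md]] := CM k.+1 i j.
apply: CkV => // [u Uu|]; last first.
  by apply: Ck_sum => // i _; exact: CkM.
by apply/lt0r_neq0/rvdot_gt0 => // i; [exact: mu_gt0 | exact: nu_gt0].
Qed.

End eigen_smooth.

(** * The Perron root and vector of an irreducible matrix *)

Section PF_vector.
Context {R : realType} {n : nat}.
Hypothesis n_gt0 : (0 < n)%N.
Implicit Types A : 'M[R]_n.+1.

(** A positive left eigenvector can only belong to the Perron root: pairing it with a positive right
    eigenvector, which exists for the transpose, equates the two eigenvalues. *)
Lemma PF_unique A r (mu : 'rV[R]_n.+1) : irreducible_mx A ->
  mu *m A = r *: mu -> (forall i, 0 < mu 0 i) -> \sum_i mu 0 i = 1 ->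
  [/\ PF_root A = r, PF_left_vector A = mu & 0 < r].
Proof.
move=> Airr muA mu0 mu1.
have [s [nu [s0 nuA nu0 _]]] :=
  exists_PF_eigenvector (n := n.+1) n_gt0 (irreducible_trmx Airr).
have rs : r = s.
  have d0 := rvdot_gt0 (ltn0Sn n) mu0 nu0.
  apply: (mulIf (lt0r_neq0 d0)).
  by rewrite -rvdotZl -muA rvdot_trmx nuA rvdotZr.
subst s.
have rE := PF_rootE (is_PF_root_eigenvectors Airr s0 muA mu0 nuA nu0).
split=> //; apply: get_unique; first by rewrite rE.
move=> v [vA _ v1]; rewrite rE in vA.
have [c vc] := eigenvector_unique Airr muA mu0 vA.
move: v1; rewrite vc; under eq_bigr do rewrite mxE.
by rewrite -mulr_sumr mu1 mulr1 => ->; rewrite scale1r.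
Qed.

Lemma PF_left_vectorP A : irreducible_mx A ->
  [/\ 0 < PF_root A, PF_left_vector A *m A = PF_root A *: PF_left_vector A,
      forall i, 0 < PF_left_vector A 0 i & \sum_i PF_left_vector A 0 i = 1].
Proof.
move=> Airr; have [r [mu [_ muA mu0 mu1]]] :=
  exists_PF_eigenvector (n := n.+1) n_gt0 Airr.
by have [-> -> r0] := PF_unique Airr muA mu0 mu1.
Qed.

(** Apply [eigenvalue_sub] with [B = A] and divide by the positive pairing. *)
Lemma PF_root_trmx A : irreducible_mx A -> PF_root A^T = PF_root A.
Proof.
move=> Airr; have [_ muA mu0 _] := PF_left_vectorP Airr.
have [_ nuA nu0 _] := PF_left_vectorP (irreducible_trmx Airr).
have d0 := rvdot_gt0 (ltn0Sn n) mu0 nu0.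
apply/eqP; rewrite -subr_eq0 -(mulIr_eq0 _ (mulIf (lt0r_neq0 d0))).
rewrite (eigenvalue_sub muA nuA) subrr mulmx0 /rvdot big1 // => i _.
by rewrite mxE mul0r.
Qed.

Lemma Ck_PF_left_vector p (U : set 'rV[R]_p) (M : 'rV[R]_p -> 'M[R]_n.+1) :
  open U -> (forall k i j, Ck k U (fun u => M u i j)) ->
  (forall u, U u -> irreducible_mx (M u)) ->
  forall k i, Ck k U (fun u => PF_left_vector (M u) 0 i).
Proof.
move=> openU CM Mirr k i.
pose mu u := PF_left_vector (M u); pose nu u := PF_left_vector (M u)^T.
have muM u : U u -> mu u *m M u = PF_root (M u) *: mu u.
  by move=> /Mirr /PF_left_vectorP[_ e _ _]; exact: e.
have mu0 u j : U u -> 0 < mu u 0 j.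
  by move=> /Mirr /PF_left_vectorP[_ _ e _]; exact: e.
have mu1 u : U u -> \sum_j mu u 0 j = 1.
  by move=> /Mirr /PF_left_vectorP[_ _ _ e]; exact: e.
have nuM u : U u -> nu u *m (M u)^T = PF_root (M u) *: nu u.
  move=> /Mirr Mu; rewrite -(PF_root_trmx Mu).
  by have [_ e _ _] := PF_left_vectorP (irreducible_trmx Mu); exact: e.
have nu0 u j : U u -> 0 < nu u 0 j.
  by move=> /Mirr /irreducible_trmx /PF_left_vectorP[_ _ e _]; exact: e.
have nu1 u : U u -> \sum_j nu u 0 j = 1.
  by move=> /Mirr /irreducible_trmx /PF_left_vectorP[_ _ _ e]; exact: e.
apply: (Ck_left_eigenvector openU CM Mirr muM mu0 mu1 nuM nu1).
exact: (Ck_eigenvalue openU CM Mirr muM mu0 mu1 nuM nu0 nu1).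
Qed.

End PF_vector.

(** * Families indexed by edges *)

Section edges.
Context {R : realType} {d : nat} {E : {set 'I_d.+1 * 'I_d.+1}}.
Implicit Types f g eta : 'rV[R]_#|E|.

(** Indexed by both the value and the membership in [E], so that one case analysis resolves both. *)
Variant at_edge_spec f x y : R -> bool -> Type :=
| AtEdge e of enum_val e = (x, y) : at_edge_spec f x y (f 0 e) true
| NotEdge : at_edge_spec f x y 0 false.

Lemma at_edgeP f x y : at_edge_spec f x y (at_edge f x y) ((x, y) \in E).
Proof.
rewrite /at_edge; case: pickP => [e /eqP exy|noe].
  by rewrite -exy enum_valP; exact: AtEdge.
case: (boolP ((x, y) \in E)) => [xyE|_]; last exact: NotEdge.
by have := noe (enum_rank_in xyE (x, y)); rewrite enum_rankK_in ?eqxx.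
Qed.

Lemma at_edge_enum f (e : 'I_#|E|) :
  at_edge f (enum_val e).1 (enum_val e).2 = f 0 e.
Proof.
have := enum_valP e; rewrite [X in X \in _]surjective_pairing.
case: at_edgeP => // e' e'E _.
by rewrite (enum_val_inj (etrans e'E (esym (surjective_pairing _)))).
Qed.

Lemma at_edge_notin f x y : (x, y) \notin E -> at_edge f x y = 0.
Proof. by case: at_edgeP. Qed.

Lemma at_edge_row (h : 'I_d.+1 -> 'I_d.+1 -> R) x y : (x, y) \in E ->
  at_edge (edge_row E h) x y = h x y.
Proof. by case: at_edgeP => // e eE _; rewrite mxE eE. Qed.

Lemma eq_at_edge f g :
  (forall x y, (x, y) \in E -> at_edge f x y = at_edge g x y) -> f = g.
Proof.
move=> fg; apply/rowP => e; rewrite -!at_edge_enum fg //.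
by rewrite -surjective_pairing enum_valP.
Qed.

Lemma edge_matrixE f x y : edge_matrix f x y = at_edge f x y.
Proof. by rewrite mxE; case: ifPn => // /at_edge_notin ->. Qed.

Lemma FplusP f : Fplus R E f <-> forall e, 0 < f 0 e.
Proof.
split=> [f0 e|f0 x y].
  by rewrite -at_edge_enum f0 // -surjective_pairing enum_valP.
by case: at_edgeP.
Qed.

(** The complement is a finite union of closed half-spaces. *)
Lemma open_Fplus : open (Fplus R E).
Proof.
rewrite (_ : Fplus R E = ~` \bigcup_(e in setT) [set f | f 0 e <= 0]);
    last first.
  apply/seteqP; split=> f.
    by move=> /FplusP f0 [e _ /=]; rewrite leNgt f0.
  move=> nf; apply/FplusP => e; rewrite ltNge; apply/negP => fe.
  by apply: nf; exists e.
apply: closed_openC; apply: closed_bigcup => [|e _]; first exact: finite_finset.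
have c : continuous (fun f : 'rV[R]_#|E| => f 0 e) by exact: coord_continuous.
by move/continuous_closedP: c => /(_ [set y | y <= 0] (@closed_le _ 0)).
Qed.

Lemma in_massE eta x : in_mass eta x = \sum_k at_edge eta k x.
Proof.
by rewrite /in_mass big_mkcond; apply: eq_bigr => k _; case: at_edgeP.
Qed.

Lemma out_massE eta x :
  \sum_(y | (x, y) \in E) at_edge eta x y = \sum_y at_edge eta x y.
Proof. by rewrite big_mkcond; apply: eq_bigr => k _; case: at_edgeP. Qed.

Lemma total_massE eta : total_mass eta = \sum_x in_mass eta x.
Proof.
under eq_bigr do rewrite in_massE.
rewrite exchange_big pair_big /= /total_mass big_mkcond.
by apply: eq_bigr => -[x y] _ /=; case: at_edgeP.
Qed.

Lemma mul_edge_matrix (v : 'rV[R]_d.+1) f y :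
  (v *m edge_matrix f) 0 y = \sum_x v 0 x * at_edge f x y.
Proof. by rewrite mxE; apply: eq_bigr => x _; rewrite edge_matrixE. Qed.

Lemma edge_row_scaleE (h : 'I_d.+1 -> R) f x y :
  at_edge (edge_row E (fun x y => h x * at_edge f x y)) x y
    = h x * at_edge f x y.
Proof.
case: (boolP ((x, y) \in E)) => xyE; first by rewrite at_edge_row.
by rewrite !at_edge_notin // mulr0.
Qed.

Lemma edge_row_tauE eta x y :
  at_edge (taubar eta) x y
    = total_mass eta * (at_edge eta x y / in_mass eta x).
Proof.
case: (boolP ((x, y) \in E)) => xyE; first by rewrite at_edge_row.
by rewrite !at_edge_notin // mul0r mulr0.
Qed.

Lemma Ck_at_edge (U : set 'rV[R]_#|E|) k x y : open U ->
  Ck k U (fun f => at_edge f x y).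
Proof.
move=> oU; case: (boolP ((x, y) \in E)) => [xyE|nE].
  apply: (Ck_ext oU) (Ck_coord oU k (enum_rank_in xyE (x, y))) => f _.
  by rewrite -at_edge_enum enum_rankK_in.
by apply: (Ck_ext oU) (Ck_cst oU k 0) => f _; rewrite at_edge_notin.
Qed.

Lemma Ck_edge_matrix (U : set 'rV[R]_#|E|) k x y : open U ->
  Ck k U (fun f => edge_matrix f x y).
Proof.
move=> oU; apply: (Ck_ext oU) (Ck_at_edge k x y oU) => f _.
by rewrite edge_matrixE.
Qed.

(** * The maps [Tbar] and [taubar] on a strongly connected graph *)

Hypothesis hd : (0 < d)%N.
Hypothesis hE : strongly_connected E.

(** The property [P] is carried along a walk from [x] to [y]. *)
Lemma edge_matrix_irreducible f : Fplus R E f -> irreducible_mx (edge_matrix f).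
Proof.
move=> f0; split=> [x y|P [x Px] Pcl y].
  rewrite edge_matrixE; case: (boolP ((x, y) \in E)) => xyE.
    exact/ltW/f0.
  by rewrite at_edge_notin.
have [p [_ pE <-]] := hE x y.
elim: p x Px pE => [//|z p IH] x Px /= /andP[xzE pE].
by apply: IH pE; apply: (Pcl x) => //; rewrite edge_matrixE; exact: f0.
Qed.

(** The last edge of a nonempty closed walk at [x] enters [x]. This keeps the denominators of
    [taubar] positive. *)
Lemma has_in_edge x : exists k, (k, x) \in E.
Proof.
have [p [+ + <-]] := hE x x.
elim/last_ind: p => [//|p y _] _; rewrite rcons_path last_rcons => /andP[_ yE].
by eexists; exact: yE.
Qed.

Lemma in_mass_gt0 eta x : Mbar R E eta -> 0 < in_mass eta x.
Proof.
move=> eta0; have [k kE] := has_in_edge x.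
rewrite /in_mass (bigD1 k) //= ltr_wpDr ?eta0 // sumr_ge0 // => j /andP[jE _].
exact/ltW/eta0.
Qed.

Lemma total_mass_gt0 eta : Mbar R E eta -> 0 < total_mass eta.
Proof.
move=> eta0; rewrite total_massE (bigD1 ord0) //= ltr_wpDr ?in_mass_gt0 //.
by rewrite sumr_ge0 // => x _; exact/ltW/in_mass_gt0.
Qed.

Lemma mu_eigen f : Fplus R E f ->
  [/\ 0 < PF_root (edge_matrix f),
      forall y, \sum_x mu_ f x * at_edge f x y
                = PF_root (edge_matrix f) * mu_ f y,
      forall x, 0 < mu_ f x & \sum_x mu_ f x = 1].
Proof.
move=> /edge_matrix_irreducible /(PF_left_vectorP hd)[r0 muA mu0 mu1].
by split=> // y; rewrite -mul_edge_matrix muA mxE.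
Qed.

Lemma mu_unique f (r : R) (m : 'I_d.+1 -> R) : Fplus R E f ->
  (forall y, \sum_x m x * at_edge f x y = r * m y) ->
  (forall x, 0 < m x) -> \sum_x m x = 1 ->
  PF_root (edge_matrix f) = r /\ mu_ f =1 m.
Proof.
move=> /edge_matrix_irreducible fA mA m0 m1; pose v : 'rV[R]_d.+1 := \row_x m x.
have vA : v *m edge_matrix f = r *: v.
  apply/rowP => y; rewrite mul_edge_matrix !mxE -mA.
  by apply: eq_bigr => x _; rewrite mxE.
have v0 x : 0 < v 0 x by rewrite mxE.
have v1 : \sum_x v 0 x = 1 by rewrite -m1; apply: eq_bigr => x _; rewrite mxE.
have [-> muE _] := PF_unique hd fA vA v0 v1.
by split=> // x; rewrite /mu_ muE mxE.
Qed.

Lemma Tbar_Mbar : set_fun (Fplus R E) (Mbar R E) Tbar.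
Proof.
move=> f f0 x y xyE; rewrite edge_row_scaleE; have [_ _ mu0 _] := mu_eigen f0.
by rewrite mulr_gt0 // f0.
Qed.

Lemma taubar_Fplus : set_fun (Mbar R E) (Fplus R E) taubar.
Proof.
move=> eta eta0 x y xyE; rewrite edge_row_tauE.
by rewrite mulr_gt0 ?divr_gt0 ?total_mass_gt0 ?in_mass_gt0 ?eta0.
Qed.

Lemma in_mass_Tbar f x : Fplus R E f ->
  in_mass (Tbar f) x = PF_root (edge_matrix f) * mu_ f x.
Proof.
move=> f0; have [_ muA _ _] := mu_eigen f0; rewrite in_massE -muA.
by apply: eq_bigr => k _; rewrite edge_row_scaleE.
Qed.

Lemma total_mass_Tbar f : Fplus R E f ->
  total_mass (Tbar f) = PF_root (edge_matrix f).
Proof.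
move=> f0; have [_ _ _ mu1] := mu_eigen f0; rewrite total_massE.
by under eq_bigr do rewrite in_mass_Tbar //; rewrite -mulr_sumr mu1 mulr1.
Qed.

Lemma TbarK : {in Fplus R E, cancel Tbar taubar}.
Proof.
move=> f /set_mem f0; have [r0 _ mu0 _] := mu_eigen f0.
apply: eq_at_edge => x y xyE.
rewrite edge_row_tauE total_mass_Tbar // in_mass_Tbar // edge_row_scaleE.
move: (mu_ f x) (mu0 x) (PF_root _) r0 => m m0 r r0.
by field; rewrite !gt_eqF.
Qed.

(** In the eigenvector equation the factor [in_mass eta x] cancels from each term, and what remains
    sums to [in_mass eta y]. *)
Lemma PF_taubar eta : Mbar R E eta ->
  PF_root (edge_matrix (taubar eta)) = total_mass eta /\
  mu_ (taubar eta) =1 (fun x => in_mass eta x / total_mass eta).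
Proof.
move=> eta0; have t0 := total_mass_gt0 eta0.
apply: mu_unique => [|y|x|].
- exact: taubar_Fplus.
- rewrite mulrCA divff ?gt_eqF // mulr1 in_massE; apply: eq_bigr => x _.
  have i0 := in_mass_gt0 x eta0; rewrite edge_row_tauE.
  by field; rewrite !gt_eqF.
- by rewrite divr_gt0 ?in_mass_gt0.
- by rewrite -mulr_suml -total_massE divff // gt_eqF.
Qed.

Lemma taubarK : {in Mbar R E, cancel taubar Tbar}.
Proof.
move=> eta /set_mem eta0; have [_ muE] := PF_taubar eta0.
have t0 := total_mass_gt0 eta0.
apply: eq_at_edge => x y xyE; rewrite edge_row_scaleE edge_row_tauE muE.
by have i0 := in_mass_gt0 x eta0; field; rewrite !gt_eqF.
Qed.

Lemma Wset_Fplus : Wset R E `<=` Fplus R E.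
Proof. by move=> w []. Qed.

Lemma Mset_Mbar : Mset R E `<=` Mbar R E.
Proof. by move=> eta []. Qed.

Lemma Wset_sum w x : Wset R E w -> \sum_y at_edge w x y = 1.
Proof. by move=> [_ w1]; rewrite -out_massE. Qed.

(** Sum the eigenvector equation over all vertices: unit row sums leave the total mass of [mu_ w]
    unchanged. *)
Lemma PF_root_Wset w : Wset R E w -> PF_root (edge_matrix w) = 1.
Proof.
move=> wW; have [_ muA _ mu1] := mu_eigen (Wset_Fplus wW).
rewrite -[LHS]mulr1 -mu1 mulr_sumr; under eq_bigr do rewrite -muA.
rewrite exchange_big /=; apply: eq_bigr => x _.
by rewrite -mulr_sumr Wset_sum // mulr1.
Qed.

(** Balance at [x]: the outgoing mass is [mu_ w x] times a unit row sum, the incoming mass is the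
    root 1 times [mu_ w x]. *)
Lemma Tbar_Mset : set_fun (Wset R E) (Mset R E) Tbar.
Proof.
move=> w wW; have w0 := Wset_Fplus wW; split.
- exact: Tbar_Mbar.
- by rewrite total_mass_Tbar // PF_root_Wset.
- move=> x; rewrite out_massE -/(in_mass (Tbar w) x) in_mass_Tbar //.
  rewrite PF_root_Wset // mul1r; under eq_bigr do rewrite edge_row_scaleE.
  by rewrite -mulr_sumr Wset_sum // mulr1.
Qed.

(** For total mass 1, the row sum at [x] is the ratio of outgoing to incoming mass, which is 1 by
    balance. *)
Lemma taubar_Wset : set_fun (Mset R E) (Wset R E) taubar.
Proof.
move=> eta [eta0 eta1 eta_bal]; split; first exact: taubar_Fplus.
move=> x; rewrite out_massE; under eq_bigr do rewrite edge_row_tauE eta1 mul1r.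
rewrite -mulr_suml -out_massE eta_bal divff // gt_eqF //.
exact: in_mass_gt0.
Qed.

Lemma Tbar_smooth : smooth_open (Fplus R E) (@Tbar R d E).
Proof.
move=> k e; have oF := open_Fplus.
pose x := (enum_val e).1; pose y := (enum_val e).2.
apply: (Ck_ext oF (f := fun f => mu_ f x * at_edge f x y)).
  by move=> f _; rewrite mxE.
apply: CkM => //; last exact: Ck_at_edge.
apply: Ck_PF_left_vector => // [l a b|f f0]; first exact: Ck_edge_matrix.
exact: edge_matrix_irreducible.
Qed.

Lemma taubar_smooth : smooth_open (Mbar R E) (@taubar R d E).
Proof.
move=> k e; have oF : open (Mbar R E) by exact: open_Fplus.
pose x := (enum_val e).1; pose y := (enum_val e).2.
apply: (Ck_ext oF (f := fun eta =>
    total_mass eta * (at_edge eta x y / in_mass eta x))).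
  by move=> eta _; rewrite mxE.
apply: CkM => //; first by apply: Ck_sum => // p _; exact: Ck_at_edge.
apply: CkM => //; first exact: Ck_at_edge.
apply: CkV => // [eta eta0|]; first by rewrite gt_eqF // in_mass_gt0.
by apply: Ck_sum => // p _; exact: Ck_at_edge.
Qed.

(** Scaling [f] scales the root; by uniqueness the normalized Perron vector does not change. *)
Lemma TbarZ f (a : R) : Fplus R E f -> 0 < a -> Tbar (a *: f) = a *: Tbar f.
Proof.
move=> f0 a0; have [r0 muA mu0 mu1] := mu_eigen f0.
have atZ x y : at_edge (a *: f) x y = a * at_edge f x y.
  by rewrite /at_edge; case: pickP => [e _|_]; rewrite ?mxE ?mulr0.
have af0 : Fplus R E (a *: f) by move=> x y xyE; rewrite atZ mulr_gt0 ?f0.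
have [_ muE] : PF_root (edge_matrix (a *: f)) = a * PF_root (edge_matrix f) /\
    mu_ (a *: f) =1 mu_ f.
  apply: mu_unique => // y; rewrite -mulrA -muA mulr_sumr.
  by apply: eq_bigr => x _; rewrite atZ mulrCA.
by apply/rowP => e; rewrite !mxE muE atZ mulrCA.
Qed.

End edges.

(** * The diffeomorphisms and the homogeneity of [Tbar] *)

Theorem lemma3p3 (R : realType) (d : nat) (E : {set 'I_d.+1 * 'I_d.+1})
    (hd : (1 <= d)%N) (hE : strongly_connected E) :
  [/\ {in Wset R E, Tbar =1 Tmap}
        /\ diffeomorphism (Wset R E) (Mset R E) Tmap,
      diffeomorphism (Fplus R E) (Mbar R E) Tbar
        /\ inverse_maps (Fplus R E) (Mbar R E) Tbar taubar
    & forall (f : 'rV[R]_#|E|) (a : R), f \in Fplus R E -> 0 < a ->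
        Tbar (a *: f) = a *: Tbar f].
Proof.
have oF : open (Fplus R E) := open_Fplus.
(* [Mbar R E] and [Fplus R E] unfold to the same set. *)
have oM : open (Mbar R E) := open_Fplus.
have inv : inverse_maps (Fplus R E) (Mbar R E) Tbar taubar.
  split; [exact: Tbar_Mbar | exact: taubar_Fplus | |].
    exact: TbarK.
  exact: taubarK.
split.
(* [Tmap] and [Tbar] have the same body, and [taubar] restricted to [Mset R E] is the inverse.
   Smoothness on both sets is inherited from the open cones containing them. *)
- split=> //; exists taubar; split.
  + split; [exact: Tbar_Mset | exact: taubar_Wset | |].
    * by move=> w /set_mem /Wset_Fplus /mem_set; exact: TbarK.
    * by move=> eta /set_mem /Mset_Mbar /mem_set; exact: taubarK.
  + by apply: (smooth_map_sub oF); [exact: Wset_Fplus | exact: Tbar_smooth].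
  + by apply: (smooth_map_sub oM); [exact: Mset_Mbar | exact: taubar_smooth].
- split=> //; exists taubar; split=> //.
  + by apply: (smooth_map_sub oF); [exact: subset_refl | exact: Tbar_smooth].
  + by apply: (smooth_map_sub oM); [exact: subset_refl | exact: taubar_smooth].
- by move=> f a /set_mem f0 a0; exact: TbarZ.
Qed.
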